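(* Let $0<q<1$ and let $\{p_n(z;q)\}_{n\in\mathbb N_0}$ be an odd $q$-Lidstone polynomial sequence of type I with associated numerical sequence $(\alpha_{2n})_{n\ge 0}$, and let $(\beta_{2n})_{n\ge0}$ be the numerical sequence determined by $(\alpha_{2n})_n$ as in the context. Then for every $n\in\mathbb N_0$ $$p_n(z;q)= \frac{1}{\beta_0}\Big[z^{2n+1}-\sum_{k=0}^{n-1} {2n+1 \brack 2k+1}_q\, \frac{\beta_{2(n-k)}}{[2(n-k)+1]_q}\, p_k(z;q)\Big].$$
   Context: Fix $0<q<1$. Put $[m]_q=\frac{1-q^m}{1-q}$, $[m]_q!=\prod_{j=1}^m[j]_q$, $[0]_q!=1$, and ${n \brack k}_q=\frac{[n]_q!}{[k]_q!\,[n-k]_q!}$ for $0\le k\le n$. $\mathbb N=\{1,2,\dots\}$, $\mathbb N_0=\mathbb N\cup\{0\}$. The Jackson $q$-derivative is $D_qf(z)=\frac{f(qz)-f(z)}{(q-1)z}$ for $z\ne0$ and $D_qf(0)=f'(0)$, so $D_qz^m=[m]_qz^{m-1}$. An odd $q$-Lidstone polynomial sequence of type I (class $q$OLS-I) is a sequence $\{p_n(z;q)\}_{n\in\mathbb N_0}$ of polynomials in $z$ with real coefficients such that $D_q^2p_n(z;q)=[2n+1]_q[2n]_q\,p_{n-1}(z;q)$ for $n\in\mathbb N$, $p_n(0;q)=0$ for $n\in\mathbb N_0$, and $p_0(z;q)=\alpha_0z$ with $\alpha_0\in\mathbb R\setminus\{0\}$. Its associated numerical sequence is $\alpha_{2n}:=D_qp_n(0;q)$,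 and $p_n(z;q)=\sum_{k=0}^n {2n+1 \brack 2k+1}_q\frac{\alpha_{2(n-k)}}{[2(n-k)+1]_q}z^{2k+1}$. The sequence $(\beta_{2n})_{n\ge0}$ is the unique real sequence with $\sum_{j=0}^n \frac{\beta_{2j}\,\alpha_{2(n-j)}}{[2j+1]_q!\,[2(n-j)+1]_q!}=\delta_{n0}$ for all $n\in\mathbb N_0$ (Kronecker delta). Empty sums are $0$. *)

(* Defs.v *)
From HB Require Import structures.
From mathcomp Require Import all_boot all_order all_algebra.
From mathcomp Require Import reals topology normedtype derive.
Set Implicit Arguments.
Unset Strict Implicit.
Unset Printing Implicit Defensive.
Import Order.TTheory GRing.Theory Num.Theory.
Import numFieldNormedType.Exports.
Local Open Scope ring_scope.

Definition qnum (R : realType) (q : R) (m : nat) : R := (1 - q ^+ m) / (1 - q).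

Definition qfact (R : realType) (q : R) (m : nat) : R :=
  \prod_(1 <= j < m.+1) qnum q j.

(* Meaningful for k <= n only: n - k is truncated subtraction. *)
Definition qbinom (R : realType) (q : R) (n k : nat) : R :=
  qfact q n / (qfact q k * qfact q (n - k)).

Definition jackson (R : realType) (q : R) (f : R -> R) : R -> R :=
  fun z => if z == 0 then derive1 f 0 else (f (q * z) - f z) / ((q - 1) * z).

(* The recurrence is stated between polynomial functions on the real line,
   which determine the polynomials. *)
Record qOLS_I (R : realType) (q : R) (p : nat -> {poly R}) : Prop := {
  qOLS_I_rec : forall n : nat, (0 < n)%N -> forall z : R,
    iter 2 (jackson q) (horner (p n)) z
      = qnum q (2 * n + 1) * qnum q (2 * n) * (p n.-1).[z];
  qOLS_I_at0 : forall n : nat, (p n).[0] = 0;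
  qOLS_I_init : exists2 a0 : R, a0 != 0 & p 0%N = a0 *: 'X }.

(* Sequences with even indices are re-indexed by half of the index:
   [alphaseq q p n] is alpha_{2n}, and [beta n] below is beta_{2n}. *)
Definition alphaseq (R : realType) (q : R) (p : nat -> {poly R}) (n : nat) : R :=
  jackson q (horner (p n)) 0.

(* This system is triangular with nonzero diagonal when [alpha 0 != 0], hence
   it has exactly one solution [beta]. *)
Definition is_betaseq (R : realType) (q : R) (alpha beta : nat -> R) : Prop :=
  forall n : nat,
    \sum_(0 <= j < n.+1)
      beta j * alpha (n - j)%N
        / (qfact q (2 * j + 1) * qfact q (2 * (n - j) + 1))
    = (n == 0%N)%:R.

(* Main.v *)
Require Import Defs.
From HB Require Import structures.
From mathcomp Require Import all_boot all_order all_algebra.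
From mathcomp Require Import reals topology normedtype derive.
From mathcomp Require Import boolp ring.
Set Implicit Arguments.
Unset Strict Implicit.
Unset Printing Implicit Defensive.
Import Order.TTheory GRing.Theory Num.Theory.
Import numFieldNormedType.Exports.
Local Open Scope ring_scope.

(** Put P_n = p_n / [2n+1]_q!, so that D_q^2 P_n = P_(n-1).  The theorem is the
    convolution identity
      sum_(j <= n) beta_(2j) / [2j+1]_q! P_(n-j) = z^(2n+1) / [2n+1]_q!
    solved for p_n.  By induction on n both sides have the same image under
    D_q^2, so they agree once their coefficients of degree 0 and 1 do; the
    latter is the defining system of the beta's. *)

(** In characteristic 0 the integers from 0 to [size (f - g) - 1] are distinct roots of [f - g], too
    many for a nonzero polynomial. *)
Lemma horner_inj (R : numDomainType) (f g : {poly R}) : horner f =1 horner g -> f = g.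
Proof.
move=> fg; apply/eqP; rewrite -subr_eq0; apply/eqP.
apply: (@roots_geq_poly_eq0 _ _ [seq i%:R | i <- iota 0 (size (f - g))]).
- by apply/allP => x _; rewrite rootE hornerD hornerN fg subrr.
- by rewrite map_inj_uniq ?iota_uniq//; apply: mulrIn; rewrite oner_eq0.
- by rewrite size_map size_iota.
Qed.

(** The Jackson derivative acting on coefficients, so that identities between polynomials can be
    checked degree by degree. *)
Definition qderiv (R : realType) (q : R) (f : {poly R}) : {poly R} :=
  \poly_(i < (size f).-1) (qnum q i.+1 * f`_i.+1).

Section QCalculus.
Variables (R : realType) (q : R).
Hypotheses (q_gt0 : 0 < q) (q_lt1 : q < 1).

Lemma qnum1 : qnum q 1 = 1.
Proof. by rewrite /qnum expr1 divff// subr_eq0 gt_eqF. Qed.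

Lemma qnum_neq0 m : (0 < m)%N -> qnum q m != 0.
Proof.
move=> m0; rewrite mulf_neq0 ?invr_eq0 ?subr_eq0 ?gt_eqF//.
by rewrite exprn_ilt1// ?ltW// -lt0n.
Qed.

Lemma qfactS m : qfact q m.+1 = qfact q m * qnum q m.+1.
Proof. by rewrite /qfact big_nat_recr. Qed.

Lemma qfact1 : qfact q 1 = 1.
Proof. by rewrite /qfact big_nat1 qnum1. Qed.

Lemma qfact_neq0 m : qfact q m != 0.
Proof.
elim: m => [|m IH]; first by rewrite /qfact big_geq// oner_eq0.
by rewrite qfactS mulf_neq0// qnum_neq0.
Qed.

Lemma coef_qderiv (f : {poly R}) i : (qderiv q f)`_i = qnum q i.+1 * f`_i.+1.
Proof.
rewrite coef_poly; case: ltnP => // le_f_i.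
by rewrite nth_default ?mulr0//; case: (size f) le_f_i.
Qed.

Lemma jackson_horner (f : {poly R}) : jackson q (horner f) = horner (qderiv q f).
Proof.
apply/funext => z; rewrite /jackson; case: eqP => [->|/eqP z0].
  by rewrite -derivE !horner_coef0 coef_deriv coef_qderiv qnum1 mul1r.
have q1 : q - 1 != 0 by rewrite subr_eq0 lt_eqF.
(* The bound [(size f).-1.+1] leaves a constant term to split off even when [f] is zero; that term
   cancels in the difference. *)
have le_f : (size f <= (size f).-1.+1)%N by exact: leqSpred.
rewrite !(horner_coef_wide _ le_f) -sumrB big_ord_recl /= !expr0 subrr add0r.
rewrite (@horner_coef_wide _ (size f).-1); last exact: size_poly.
rewrite mulr_suml; apply: eq_bigr => i _.
rewrite coef_qderiv /qnum /bump /= add1n exprMn !exprS.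
field.
by rewrite z0 q1 -oppr_eq0 opprB q1.
Qed.

End QCalculus.

Section OddQLidstone.
Variables (R : realType) (q : R) (p : nat -> {poly R}).
Hypotheses (q_gt0 : 0 < q) (q_lt1 : q < 1) (hp : qOLS_I q p).

Definition qLidstone_normalized n := (qfact q (2 * n + 1))^-1 *: p n.
Local Notation P := qLidstone_normalized.

(** This is D_q^2 P_(n+1) = P_n read on coefficients: the factor in the recurrence equals [2n+3]_q!
    / [2n+1]_q!. *)
Lemma coef_qLidstone_normalizedS n i :
  (qnum q i.+1 * qnum q i.+2) * (P n.+1)`_i.+2 = (P n)`_i.
Proof.
have e : qderiv q (qderiv q (p n.+1))
    = (qnum q (2 * n.+1 + 1) * qnum q (2 * n.+1)) *: p n.
  apply: horner_inj => z.
  by rewrite -!jackson_horner// hornerZ -(qOLS_I_rec hp (ltn0Sn n) z).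
have := congr1 (fun f : {poly R} => f`_i) e.
rewrite !(coef_qderiv, coefZ) mulnS add2n !addn1 mulrA => ei.
rewrite (qfactS q (2 * n).+2) (qfactS q (2 * n).+1).
have h1 : qnum q (2 * n).+2 != 0 by exact: qnum_neq0.
have h2 : qnum q (2 * n).+3 != 0 by exact: qnum_neq0.
have h3 : qfact q (2 * n).+1 != 0 by exact: qfact_neq0.
rewrite mulrCA ei; field.
by rewrite h1 h2 h3.
Qed.

Lemma coef0_qLidstone_normalized n : (P n)`_0 = 0.
Proof. by rewrite coefZ -horner_coef0 (qOLS_I_at0 hp) mulr0. Qed.

Lemma coef1_qLidstone_normalized n :
  (P n)`_1 = alphaseq q p n / qfact q (2 * n + 1).
Proof.
by rewrite coefZ /alphaseq jackson_horner// horner_coef0 coef_qderiv qnum1// mul1r mulrC.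
Qed.

Lemma coef_qLidstone_normalized0 i : (P 0)`_i.+2 = 0.
Proof. by case: (qOLS_I_init hp) => a _ p0; rewrite coefZ p0 coefZ coefX !mulr0. Qed.

Lemma beta_convolution (beta : nat -> R) n : is_betaseq q (alphaseq q p) beta ->
  \sum_(0 <= j < n.+1) (beta j / qfact q (2 * j + 1)) *: P (n - j)
    = (qfact q (2 * n + 1))^-1 *: 'X^(2 * n + 1).
Proof.
move=> hbeta; elim: n => [|n IH]; apply/polyP => -[|[|i]].
all: rewrite ?coef_sum ?coefZ ?coefXn.
(* Degree 0: every P_j vanishes at 0 and the exponent on the right is positive. *)
all: try (rewrite big1 => [|j _]; last by rewrite coefZ coef0_qLidstone_normalized mulr0).
all: try by rewrite addn1 mulr0.
- rewrite big_nat1 coefZ coef1_qLidstone_normalized qfact1// invr1 mulr1.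
  by have := hbeta 0%N; rewrite big_nat1 qfact1// !mulr1 !divr1.
- by rewrite big_nat1 coefZ coef_qLidstone_normalized0 !mulr0.
(* Degree 1: the left side is that of the equation of index [n.+1] defining [beta], whose right side
   is 0. *)
- have -> : (1 == 2 * n.+1 + 1)%N = false by rewrite mulnS addn1.
  rewrite mulr0; rewrite -[RHS](hbeta n.+1); apply: eq_bigr => j _.
  by rewrite coefZ coef1_qLidstone_normalized invfM !mulrA [_ / _ * _]mulrAC.
(* Degree at least 2: multiplying by the nonzero factor that D_q^2 produces lowers each index of P
   by one. The last term, a multiple of P_0, drops out, and the induction hypothesis in degree [i]
   applies. *)
have c0 : qnum q i.+1 * qnum q i.+2 != 0 by rewrite mulf_neq0// qnum_neq0.
apply: (mulfI c0); rewrite big_nat_recr//= coefZ subnn coef_qLidstone_normalized0.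
rewrite mulr0 addr0 mulr_sumr.
have := congr1 (fun f : {poly R} => f`_i) IH.
rewrite coef_sum coefZ coefXn => IHi.
transitivity ((qfact q (2 * n + 1))^-1 * (i == 2 * n + 1)%N%:R).
  rewrite -IHi; apply: eq_big_nat => j /andP[_ jn].
  by rewrite subSn// [in LHS]coefZ mulrCA coef_qLidstone_normalizedS !coefZ.
rewrite mulnS -addnA add2n 2!qfactS !eqSS.
case: eqP => [->|_]; last by rewrite !mulr0.
have h1 : qnum q (2 * n + 1).+1 != 0 by exact: qnum_neq0.
have h2 : qnum q (2 * n + 1).+2 != 0 by exact: qnum_neq0.
have h3 : qfact q (2 * n + 1) != 0 by exact: qfact_neq0.
by field; rewrite h1 h2 h3.
Qed.

End OddQLidstone.

Theorem theorem2p16 (R : realType) (q : R) (q_gt0 : 0 < q) (q_lt1 : q < 1)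
    (p : nat -> {poly R}) (hp : qOLS_I q p)
    (beta : nat -> R) (hbeta : is_betaseq q (alphaseq q p) beta) (n : nat) :
  p n = (beta 0%N)^-1 *:
    ('X^(2 * n + 1)
     - \sum_(0 <= k < n)
         (qbinom q (2 * n + 1) (2 * k + 1)
            * (beta (n - k)%N / qnum q (2 * (n - k) + 1))) *: p k).
Proof.
(* Otherwise the defining system at index 0 would read 0 = 1. *)
have b0 : beta 0%N != 0.
  apply: contra_eq_neq (hbeta 0%N) => b0.
  by rewrite big_nat1 b0 !mul0r eq_sym oner_eq0.
have F0 : qfact q (2 * n + 1) != 0 by exact: qfact_neq0.
have := congr1 ( *:%R (qfact q (2 * n + 1))) (beta_convolution q_gt0 q_lt1 hp n hbeta).
rewrite scalerA divff// scale1r => <-.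
(* After reversal the sum runs over the index of [p]; its last term gives [beta 0 *: p n], and the
   others cancel one by one against the subtracted sum. *)
rewrite big_nat_rev /= big_nat_recr//= add0n subSS subnn subn0 qfact1// divr1.
rewrite [_ *: (_ + beta 0%N *: _)]scalerDr /qLidstone_normalized !scalerA mulrAC divff// mul1r scaler_sumr.
rewrite addrAC -sumrB big_nat_cond big1 => [|k /andP[/andP[_ kn] _]].
  by rewrite add0r scalerA mulVf// scale1r.
rewrite subSS subKn 1?ltnW// !scalerA -scalerBl.
(* As (2n+1) - (2k+1) = 2(n-k), dividing by [2(n-k)+1]_q completes the [2(n-k)]_q! of the binomial
   to the factorial in the convolution. *)
rewrite /qbinom subnDr -mulnBr.
have -> : qfact q (2 * (n - k) + 1)
    = qfact q (2 * (n - k)) * qnum q (2 * (n - k) + 1) by rewrite addn1 qfactS.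
have h1 : qnum q (2 * (n - k) + 1) != 0 by rewrite qnum_neq0// addn1.
have h2 : qfact q (2 * (n - k)) != 0 by exact: qfact_neq0.
have h3 : qfact q (2 * k + 1) != 0 by exact: qfact_neq0.
rewrite [X in X *: _](_ : _ = 0) ?scale0r//.
by field; rewrite h1 h2 h3.
Qed.
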